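(* Let $\beta\in(-2,-1)$, $c\in(0,1)$, and let $n\geq 3$ be an integer with $n-1>\frac{\beta}{c-1}$. Assume that $M_n(x;\beta,c)$ and $M_{n-1}(x;\beta,c)$ have no common zeros. For $m\in\{n-1,n\}$ let $x_{1,m}<x_{2,m}<\dots<x_{m,m}$ denote the zeros of the monic Meixner polynomial $M_m(x;\beta,c)$. Then the $n$ zeros of $(x+\beta)M_{n-1}(x;\beta,c)$ interlace with the $n+1$ zeros of $(x+\beta+1)M_n(x;\beta,c)$ as follows: $$0<x_{1,n}<x_{1,n-1}<-\beta-1<x_{2,n-1}<x_{2,n}<-\beta<x_{3,n},$$ and, for each $k\in\{3,\dots,n-1\}$, $x_{k,n}<x_{k,n-1}<x_{k+1,n}$.
   Context: Monic Meixner polynomials are defined by $$M_n(x;\beta,c)=\left(\frac{c}{c-1}\right)^n(\beta)_n\sum_{k=0}^{n}\frac{(-n)_k(-x)_k(1-\frac1c)^k}{(\beta)_k\,k!},$$ for real $\beta,c$ with $c\neq 0$ and $\beta\notin\{-1,-2,\dots,-n+1\}$, where $(\alpha)_0=1$ and $(\alpha)_k=\alpha(\alpha+1)\cdots(\alpha+k-1)$ for $k\geq1$. For $\beta\in(-2,-1)$, $c\in(0,1)$ and $m>\frac{\beta}{c-1}$, the zeros of $M_m(x;\beta,c)$ are real, simple and positive. *)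

(* Defs.v *)
From HB Require Import structures.
From mathcomp Require Import all_boot all_order all_algebra.
From mathcomp Require Import reals.
Set Implicit Arguments. Unset Strict Implicit. Unset Printing Implicit Defensive.
Import Order.TTheory GRing.Theory Num.Theory.
Local Open Scope ring_scope.

Definition poch {R : realType} (a : R) (k : nat) : R :=
  \prod_(i < k) (a + i%:R).

Definition meixner {R : realType} (n : nat) (beta c : R) (x : R) : R :=
  (c / (c - 1)) ^+ n * poch beta n *
  \sum_(k < n.+1)
     (poch (- (n%:R)) k * poch (- x) k * (1 - c^-1) ^+ k
       / (poch beta k * (k`!)%:R)).

Definition ordered_zeros {R : realType} (f : R -> R) (m : nat) (xs : nat -> R) : Prop :=
  (forall i j : nat, (1 <= i)%N -> (i < j)%N -> (j <= m)%N -> xs i < xs j) /\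
  (forall y : R, f y = 0 <-> exists2 k : nat, (1 <= k <= m)%N & y = xs k).

(* Main.v *)
Require Import Defs.
From HB Require Import structures.
From mathcomp Require Import all_boot all_order all_algebra.
From mathcomp Require Import boolp reals.
From mathcomp Require Import polyrcf.
From mathcomp Require Import ring lra zify.
Import Order.TTheory GRing.Theory Num.Theory.
Local Open Scope ring_scope.

(* Write M_n for the Meixner polynomial with parameter b in (-2,-1), and r_k for
   x |-> M_k(x - 2; b + 2, c), which satisfies a three-term recurrence with
   positive coefficients, so that its zeros exceed 2 and those of consecutive r_k
   interlace. Since M_n is a combination of r_n, r_(n-1), r_(n-2) with explicit
   coefficients, its signs at the zeros of r_(n-1) and r_(n-2) give n - 2 zeros
   beyond 2; the signs of M_n at 0, -b-1 (where the hypothesis on n enters) and 1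
   give the other two, in (0,-b-1) and (-b-1,1). At a zero x of M_n a contiguous
   relation makes M_(n-1)(x) a positive multiple of x(x-1) r_(n-2)(x). This
   determines the signs of M_(n-1) at the zeros of M_n, and the intermediate value
   theorem then locates all n - 1 zeros of M_(n-1). *)

(** * Algebraic identities for the monic Meixner polynomials *)

Section MeixnerPolynomials.
Context {R : realType}.
Implicit Types (u b c x : R) (n k : nat).

Lemma pochS b n : poch b n.+1 = poch b n * (b + n%:R).
Proof. by rewrite /poch big_ord_recr. Qed.

Lemma pochSl b n : poch b n.+1 = b * poch (b + 1) n.
Proof.
rewrite /poch big_ord_recl addr0; congr (_ * _).
by apply: eq_bigr => i _; rewrite lift0 -natr1 addrAC addrA.
Qed.

Lemma pochD b m n : poch b (m + n) = poch b m * poch (b + m%:R) n.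
Proof.
elim: n => [|n IH]; first by rewrite addn0 {3}/poch big_ord0 mulr1.
by rewrite addnS !pochS IH natrD addrA mulrA.
Qed.

Lemma poch_neq0 b n : (forall i, b + i%:R != 0) -> poch b n != 0.
Proof. by move=> h; apply/prodf_neq0 => i _; exact: h. Qed.

Lemma poch_gt0 b n : 0 < b -> 0 < poch b n.
Proof.
by move=> b0; apply: prodr_gt0 => i _; apply: ltr_wpDr => //; exact: ler0n.
Qed.

(* The monic Meixner polynomial, with u = c / (c - 1), so that 1 - u = 1 / (1 - c). *)
Fixpoint mpol u n b : {poly R} :=
  if n is n'.+1 then
    'X * (mpol u n' (b + 1) \Po ('X - 1%:P)) + (u * (b + n'%:R)) *: mpol u n' b
  else 1.

Lemma mpol0 u b x : (mpol u 0 b).[x] = 1.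
Proof. by rewrite /= hornerE. Qed.

Lemma mpolS u n b x : (mpol u n.+1 b).[x] =
  x * (mpol u n (b + 1)).[x - 1] + u * (b + n%:R) * (mpol u n b).[x].
Proof. by rewrite /= !hornerE horner_comp !hornerE. Qed.

Lemma mpol_monic_size u n b : mpol u n b \is monic /\ size (mpol u n b) = n.+1.
Proof.
elim: n b => [|n IH] b; first by rewrite /= monic1 size_poly1.
have [m1 s1] := IH (b + 1); have [m2 s2] := IH b.
have sX : size ('X - 1%:P : {poly R}) = 2 by rewrite size_XsubC.
set q := mpol u n (b + 1) \Po ('X - 1%:P).
have sq : size q = n.+1 by rewrite size_comp_poly2.
have mq : q \is monic.
  by rewrite monicE lead_coef_comp ?sX // lead_coefXsubC expr1n mulr1 (monicP m1).
have sXq : size ('X * q) = n.+2.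
  by rewrite mulrC size_mulX ?sq // -size_poly_eq0 sq.
have lt : (size ((u * (b + n%:R)) *: mpol u n b)%R < size ('X * q)%R)%N.
  by rewrite sXq ltnS (leq_trans (size_scale_leq _ _)) // s2.
split; first by rewrite monicE /= lead_coefDl // mulrC lead_coefMX (monicP mq).
by rewrite /= size_polyDl // sXq.
Qed.

(** Induction on n with b and x free: the step uses the identity at (b, x) and at (b + 1, x - 1),
    linked by [mpolS]. *)
Lemma mpol_shift u n b x : (mpol u n.+1 b).[x] =
  (mpol u n.+1 (b + 1)).[x - 1]
    + n.+1%:R * (1 - u) * (mpol u n (b + 1)).[x - 1].
Proof.
elim: n b x => [|n IH] b x.
  by rewrite !mpolS !mpol0; ring.
have e1 := mpolS u n.+1 b x; have e2 := mpolS u n.+1 (b + 1) (x - 1).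
have e3 := mpolS u n (b + 1) (x - 1).
have e4 := IH b x; have e5 := IH (b + 1) (x - 1).
rewrite e1 e2 e4.
have -> : (mpol u n.+1 (b + 1 + 1)).[x - 1 - 1] = (mpol u n.+1 (b + 1)).[x - 1]
     - n.+1%:R * (1 - u) * (mpol u n (b + 1 + 1)).[x - 1 - 1] by rewrite e5; ring.
rewrite e3 -!natr1; ring.
Qed.

(** Obtained by eliminating the values at (b + 1, x - 1) between [mpolS] and [mpol_shift]. *)
Lemma mpol_rec u n b x : (mpol u n.+2 b).[x] =
  (x + u * (b + n.+1%:R) - n.+1%:R * (1 - u)) * (mpol u n.+1 b).[x]
   + n.+1%:R * (1 - u) * (u * (b + n%:R)) * (mpol u n b).[x].
Proof.
rewrite mpolS.
have e1 := mpolS u n b x; have e2 := mpol_shift u n b x.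
have -> : (mpol u n.+1 (b + 1)).[x - 1] = (mpol u n.+1 b).[x]
     - n.+1%:R * (1 - u) * (mpol u n (b + 1)).[x - 1] by rewrite e2; ring.
have -> : x * ((mpol u n.+1 b).[x] - n.+1%:R * (1 - u) * (mpol u n (b + 1)).[x - 1])
  = x * (mpol u n.+1 b).[x] - n.+1%:R * (1 - u) * (x * (mpol u n (b + 1)).[x - 1])
  by ring.
have -> : x * (mpol u n (b + 1)).[x - 1] =
  (mpol u n.+1 b).[x] - u * (b + n%:R) * (mpol u n b).[x] by rewrite e1; ring.
rewrite -!natr1; ring.
Qed.

Lemma mpol_at0 u n b : (mpol u n b).[0] = u ^+ n * poch b n.
Proof.
elim: n => [|n IH]; first by rewrite mpol0 /poch big_ord0 expr0 mulr1.
by rewrite mpolS IH pochS exprS; ring.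
Qed.

Lemma mpol_at1 u n b :
  (mpol u n.+1 b).[1] = u ^+ n * poch (b + 1) n * (n.+1%:R + u * b).
Proof.
elim: n => [|n IH].
  by rewrite mpolS !mpol0 /poch big_ord0; ring.
rewrite mpolS subrr mpol_at0 IH !pochS !exprS -!natr1; ring.
Qed.

(** Replacing b by b + 1 sends the point -b - 1 to -b - 2, which is exactly the shifted argument in
    [mpolS], so the induction stays on these points. For u = c / (c - 1) the last factor compares b
    / (c - 1) with the degree. *)
Lemma mpol_at_Nb1 u n b :
  (mpol u n.+1 b).[- b - 1] =
  poch (b + 1) n * (u - 1) ^+ n * ((u - 1) * b - n.+1%:R).
Proof.
elim: n b => [|n IH] b.
  by rewrite mpolS !mpol0 /poch big_ord0; ring.
rewrite mpolS IH.
have -> : - b - 1 - 1 = - (b + 1) - 1 by ring.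
rewrite IH (pochS (b + 1)) exprS -!natr1.
have -> : (- b - 1) * (poch (b + 1 + 1) n * (u - 1) ^+ n * ((u - 1) * (b + 1) - (n%:R + 1)))
 = - ((b + 1) * poch (b + 1 + 1) n) * ((u - 1) ^+ n * ((u - 1) * (b + 1) - (n%:R + 1))) by ring.
rewrite -pochSl pochS; ring.
Qed.

(* The contiguous relation transporting the sign of the orthogonal polynomial
   on the left to [mpol u k.+1 b] at the zeros of [mpol u k.+2 b]. *)
Lemma mpol_contiguous u k b x :
  k.+1%:R * (1 - u) * (x * (x - 1)) * (mpol u k (b + 2)).[x - 2] =
  (k.+1%:R * (1 - u) + u * (b + k.+1%:R)) * (mpol u k.+2 b).[x]
  + - u * (b + k.+1%:R) * (x + k.+1%:R + u * b) * (mpol u k.+1 b).[x].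
Proof.
have e1 := mpolS u k.+1 b x; have e2 := mpolS u k (b + 1) (x - 1).
have e3 := mpol_shift u k b x.
have h1 : b + 1 + 1 = b + 2 by ring.
have h2 : x - 1 - 1 = x - 2 by ring.
rewrite h1 h2 in e2.
have -> : k.+1%:R * (1 - u) * (x * (x - 1)) * (mpol u k (b + 2)).[x - 2] =
 k.+1%:R * (1 - u) * x * ((x - 1) * (mpol u k (b + 2)).[x - 2]) by ring.
have -> : (x - 1) * (mpol u k (b + 2)).[x - 2] = (mpol u k.+1 (b + 1)).[x - 1]
  - u * (b + 1 + k%:R) * (mpol u k (b + 1)).[x - 1] by rewrite e2; ring.
rewrite e1 e3 -!natr1; ring.
Qed.

(** Iterating [mpol_shift] reaches the parameter b + 2, which is positive when b > -2, so that
    [mpol_interlacing] applies to the polynomials on the right. *)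
Lemma mpol_shift2 u k b x : (mpol u k.+2 b).[x] =
  (mpol u k.+2 (b + 2)).[x - 2]
  + 2 * k.+2%:R * (1 - u) * (mpol u k.+1 (b + 2)).[x - 2]
  + k.+2%:R * k.+1%:R * (1 - u) ^+ 2 * (mpol u k (b + 2)).[x - 2].
Proof.
have h1 : b + 1 + 1 = b + 2 by ring.
have h2 : x - 1 - 1 = x - 2 by ring.
rewrite mpol_shift (mpol_shift _ k.+1 (b + 1)) (mpol_shift _ k (b + 1)) h1 h2.
ring.
Qed.

(** * Falling factorials and the hypergeometric sum *)

Definition falling x k : R := \prod_(i < k) (x - i%:R).

Lemma fallingS x k : falling x k.+1 = falling x k * (x - k%:R).
Proof. by rewrite /falling big_ord_recr. Qed.

Lemma fallingSl x k : falling x k.+1 = x * falling (x - 1) k.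
Proof.
rewrite /falling big_ord_recl subr0; congr (_ * _).
by apply: eq_bigr => i _; rewrite lift0 -natr1 opprD addrCA addrC.
Qed.

Lemma poch_opp x k : poch (- x) k = (-1) ^+ k * falling x k.
Proof.
elim: k => [|k IH]; first by rewrite /poch /falling !big_ord0 mulr1.
by rewrite pochS fallingS IH exprS; ring.
Qed.

Lemma falling_nat n k : falling n%:R k = (n ^_ k)%:R.
Proof.
elim: k => [|k IH]; first by rewrite /falling big_ord0 ffactn0.
rewrite fallingS IH ffactnSr natrM.
have [kn|nk] := leqP k n; first by rewrite natrB.
by rewrite ffact_small // !mul0r.
Qed.

(** A division-free form of the defining sum. In the induction the factor x of [mpolS] raises
    [falling (x - 1) i] to [falling x i.+1], and Pascal's rule merges the two sums. *)
Lemma mpol_expansion u n b x : (mpol u n b).[x] =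
  \sum_(k < n.+1) 'C(n, k)%:R * u ^+ (n - k) * poch (b + k%:R) (n - k) * falling x k.
Proof.
elim: n b x => [|n IH] b x.
  by rewrite mpol0 big_ord1 /poch /falling !big_ord0 !expr0 bin0 !mulr1.
rewrite mpolS !IH.
rewrite [in RHS]big_ord_recl [in X in _ + X]big_ord_recl.
rewrite !bin0 !subn0 !addr0 !mul1r.
rewrite [X in falling x X]/= /falling !big_ord0 !mulr1 -/(falling _ _).
rewrite [poch b n.+1]pochS exprS.
set S1 := \sum_(i < n.+1) _; set S2 := \sum_(i < n) _; set S3 := \sum_(i < n.+1) _.
suff : x * S1 + u * (b + n%:R) * S2 = S3.
  by move=> <-; ring.
(* Pad the shorter sum with a term whose binomial coefficient vanishes, so that all sums share one
   index range. *)
have -> : S2 = \sum_(i < n.+1) 'C(n, i.+1)%:R * u ^+ (n - i.+1) * poch (b + i.+1%:R) (n - i.+1) * falling x i.+1.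
  by rewrite big_ord_recr /= bin_small // !mul0r addr0; apply: eq_bigr.
rewrite /S1 /S3 !big_distrr -big_split; apply: eq_bigr => i _ /=.
rewrite ?lift0 /= ?/bump ?add1n binS natrD subSS -/(falling (x - 1) i) -/(falling x i.+1) fallingSl.
rewrite -[b + 1 + _]addrA nat1r.
have [lt|ge] := ltnP i n; last first.
  by rewrite (@bin_small n i.+1) //; ring.
rewrite -(subnSK lt) pochS exprS.
have -> : b + i.+1%:R + (n - i.+1)%:R = b + n%:R by rewrite -addrA -natrD subnKC.
ring.
Qed.

(** Termwise: the signs of (-n)_k and (-x)_k cancel, 1 - 1/c is the inverse of c / (c - 1), and
    (b)_n / (b)_k = (b + k)_(n-k) since (b)_k is nonzero. *)
Lemma meixnerE n b c x : c != 0 -> c != 1 -> (forall i, b + i%:R != 0) ->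
  meixner n b c x = (mpol (c / (c - 1)) n b).[x].
Proof.
move=> c0 c1 hb; rewrite mpol_expansion /meixner big_distrr /=.
apply: eq_bigr => -[k kn] _ /=; rewrite ltnS in kn.
have c1' : c - 1 != 0 by rewrite subr_eq0.
have f0 : (k`!)%:R != 0 :> R by rewrite pnatr_eq0 -lt0n fact_gt0.
have p0 : poch b k != 0 by exact: poch_neq0.
rewrite !poch_opp falling_nat -bin_ffact natrM -{1 2}(subnKC kn) pochD exprD.
have -> : 1 - c^-1 = (c / (c - 1))^-1 by field; rewrite c0 c1'.
set v := c / (c - 1); have v0 : v != 0 by rewrite mulf_neq0 ?invr_neq0.
have sg : (-1) ^+ k * (-1) ^+ k = 1 :> R by rewrite -exprMn mulrNN mulr1 expr1n.
rewrite exprVn.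
transitivity (((-1) ^+ k * (-1) ^+ k) * ('C(n, k)%:R * v ^+ (n - k) * poch (b + k%:R) (n - k) * falling x k)).
  by field; rewrite p0 f0 expf_neq0.
by rewrite sg mul1r.
Qed.

End MeixnerPolynomials.

(** * Sign changes, interlacing and enumeration of real zeros *)

Section InterlacingZeros.
Local Set Implicit Arguments. Local Unset Strict Implicit.
Context {R : realType}.
Implicit Types (p : {poly R}) (x l : R) (n k m : nat).

(** Signs are recorded as positivity of (-1)^m p(x), so opposite signs become a parity condition.
    Nonvanishing at both ends puts the zero in the open interval. *)
Lemma poly_ivt_signs p x y m n : x < y -> odd (m + n) ->
  0 < (-1) ^+ m * p.[x] -> 0 < (-1) ^+ n * p.[y] ->
  exists2 z, x < z < y & p.[z] = 0.
Proof.
move=> xy omn px py.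
pose q := (-1) ^+ n *: p.
have qx : q.[x] < 0.
  rewrite hornerZ -signr_odd -oppr_gt0 -mulNr.
  suff -> : - (-1) ^+ odd n = (-1) ^+ m :> R by [].
  rewrite -(signr_odd _ m).
  by move: omn; rewrite oddD; case: (odd m); case: (odd n) => //= _;
    rewrite ?expr0 ?expr1 ?opprK.
have qy : 0 < q.[y] by rewrite hornerZ.
have [|z /andP[xz zy] /rootP] := @poly_ivt _ q x y (ltW xy).
  by rewrite (ltW qx) (ltW qy).
rewrite hornerZ => /eqP; rewrite mulf_eq0 signr_eq0 /= => /eqP pz.
exists z => //; rewrite !lt_def zy xz !andbT; apply/andP; split.
  by apply: contraTneq qx => <-; rewrite hornerZ pz mulr0 ltxx.
by apply: contraTneq qy => ->; rewrite hornerZ pz mulr0 ltxx.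
Qed.

(** Exactly k - i of the factors are negative. *)
Lemma prod_sub_sign x (z : nat -> R) k i : (i <= k)%N ->
  (forall j, (j < i)%N -> z j < x) ->
  (forall j, (i <= j < k)%N -> x < z j) ->
  0 < (-1) ^+ (k - i) * \prod_(j < k) (x - z j).
Proof.
elim: k => [|k IH] ik lo hi.
  by rewrite big_ord0 mulr1 sub0n ltr01.
rewrite big_ord_recr /=; move: ik; rewrite leq_eqVlt => /predU1P[ei|].
  rewrite ei subnn mul1r mulr_gt0 ?subr_gt0 ?lo ?ei //.
  by apply: prodr_gt0 => j _; rewrite subr_gt0 lo // ei (leq_trans (ltn_ord j)).
rewrite ltnS => ik; rewrite subSn // exprS mulrA [_ * _ * \prod_(_ < _) _]mulrC.
have h : 0 < (-1) ^+ (k - i) * \prod_(j < k) (x - z j).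
  by apply: IH => // j /andP[ij jk]; apply: hi; rewrite ij ltnW.
have := hi k; rewrite ik ltnSn => /(_ isT) xz.
rewrite -[ltRHS]/(_ * (x - z k)).
have -> : \prod_(j < k) (x - z j) * (-1 * (-1) ^+ (k - i)) * (x - z k) =
   ((-1) ^+ (k - i) * \prod_(j < k) (x - z j)) * (z k - x) by ring.
by rewrite mulr_gt0 // subr_gt0.
Qed.

Lemma step_lt (f : nat -> R) m : (forall i, (i < m)%N -> f i < f i.+1) ->
  forall i j, (i < j)%N -> (j <= m)%N -> f i < f j.
Proof.
move=> h i; elim=> // j IH; rewrite ltnS leq_eqVlt => /predU1P[->|ij] jm.
  exact: h.
by apply: lt_trans (h _ jm); apply: IH => //; exact: ltnW.
Qed.

Lemma step_le (f : nat -> R) m : (forall i, (i < m)%N -> f i < f i.+1) ->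
  forall i j, (i <= j)%N -> (j <= m)%N -> f i <= f j.
Proof.
move=> h i j; rewrite leq_eqVlt => /predU1P[->//|ij] jm.
apply: ltW; exact: (step_lt h).
Qed.

Lemma monic_prod_roots p (w : nat -> R) k : p \is monic -> size p = k.+1 ->
  (forall i j, (i < j)%N -> (j < k)%N -> w i < w j) ->
  (forall i, (i < k)%N -> p.[w i] = 0) ->
  forall x, p.[x] = \prod_(i < k) (x - w i).
Proof.
move=> mp sp winc wroot x.
rewrite (@all_roots_prod_XsubC _ p (mkseq w k)).
- rewrite (monicP mp) scale1r horner_prod big_map -[X in iota 0 X](subn0 k) -[iota _ _]/(index_iota 0 k) big_mkord.
  by apply: eq_bigr => i _; rewrite hornerXsubC.
- by rewrite size_mkseq.
- apply/allP => v /mapP[i]; rewrite mem_iota /= => ik ->.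
  exact/rootP/wroot.
- rewrite uniq_rootsE map_inj_in_uniq ?iota_uniq // => i j.
  rewrite !mem_iota /= !add0n => ik jk e.
  by case: (ltngtP i j) => // ij;
    [have := winc _ _ ij jk | have := winc _ _ ij ik]; rewrite e ltxx.
Qed.

(** Zeros are indexed from 0. The factorisations say that no zero is missing, so signs can be read
    off by counting the zeros to the right of a point. *)
Definition interlacing_zeros p q l k (y z : nat -> R) : Prop :=
  [/\ forall x, p.[x] = \prod_(i < k.+1) (x - y i),
      forall x, q.[x] = \prod_(i < k) (x - z i),
      l < y 0 &
      forall i, (i < k)%N -> y i < z i < y i.+1].

Lemma interlacing_lt p q l k y z : interlacing_zeros p q l k y z ->
  forall i j, (i < j)%N -> (j <= k)%N -> y i < z i /\ z i < y j.
Proof.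
move=> [_ _ _ yz] i j ij jk.
have h : forall i, (i < k)%N -> y i < y i.+1.
  by move=> i' /yz /andP[]; exact: lt_trans.
have /andP[h1 h2] := yz _ (leq_trans ij jk); split=> //.
by apply: lt_le_trans h2 _; apply: (step_le h).
Qed.

Lemma interlacing_sign_q p q l k y z : interlacing_zeros p q l k y z ->
  forall x i, (i <= k)%N ->
  (forall j, (j < i)%N -> z j < x) -> (forall j, (i <= j < k)%N -> x < z j) ->
  0 < (-1) ^+ (k - i) * q.[x].
Proof. by move=> [_ qE _ _] x i ik lo hi; rewrite qE; exact: prod_sub_sign. Qed.

Lemma interlacing_sign_qy p q l k y z : interlacing_zeros p q l k y z ->
  forall i, (i <= k)%N -> 0 < (-1) ^+ (k - i) * q.[y i].
Proof.
move=> H i ik; apply: (interlacing_sign_q H) => // j.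
  by move=> ji; have [] := interlacing_lt H ji ik.
move=> /andP[ij jk]; have [yz _] := interlacing_lt H (ltnSn j) jk.
case: (ltngtP i j) ij => // [ij|->//] _.
have [h1 h2] := interlacing_lt H ij (ltnW jk).
exact: lt_trans (lt_trans h1 h2) yz.
Qed.

Lemma interlacing_sign_pz p q l k y z : interlacing_zeros p q l k y z ->
  forall i, (i < k)%N -> 0 < (-1) ^+ (k - i) * p.[z i].
Proof.
move=> H i ik; have [-> _ _ yz] := H; rewrite -subSS.
apply: prod_sub_sign => [|j|j]; first exact: leqW.
  rewrite ltnS leq_eqVlt => /predU1P[->|ji]; first by case/andP: (yz _ ik).
  have [h1 h2] := interlacing_lt H ji (ltnW ik).
  by apply: lt_trans (lt_trans h1 h2) _; case/andP: (yz _ ik).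
by move=> /andP[ij jk]; have [] := interlacing_lt H ij jk.
Qed.

(** At a zero of p_(k+1) the recurrence leaves -B_k p_k, whose sign alternates by the interlacing
    already known. Together with the signs at l and far to the right, this gives k + 2 sign changes
    of p_(k+2), all beyond l. *)
Lemma three_term_interlacing (p : nat -> {poly R}) (A : nat -> R -> R)
    (B : nat -> R) l :
  (forall k, p k \is monic /\ size (p k) = k.+1) ->
  (forall k x, (p k.+2).[x] = A k x * (p k.+1).[x] - B k * (p k).[x]) ->
  (forall k, 0 < B k) ->
  (forall k, 0 < (-1) ^+ k * (p k).[l]) ->
  forall k, exists y z, interlacing_zeros (p k.+1) (p k) l k y z.
Proof.
move=> pm prec B0 pl; elim=> [|k [y [z H]]].
  have [m1 s1] := pm 1; have [m0 s0] := pm 0.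
  have p0 x : (p 0).[x] = 1.
    by rewrite (@monic_prod_roots _ (fun=> 0) 0 m0 s0) // big_ord0.
  have [/= T] := @poly_pinfty_gt_lc _ (p 1) (eq_ind_r (fun v => 0 < v) ltr01 (monicP m1)).
  rewrite (monicP m1) => hT.
  have lM : l < Num.max T (l + 1) by rewrite lt_max ltrDl ltr01 orbT.
  have [||x /andP[lx _] px] := @poly_ivt_signs (p 1) l _ 1 0 lM isT; first exact: pl.
    by rewrite mul1r (lt_le_trans ltr01) // hT // le_max lexx.
  (* The family of zeros of the constant p_0 is empty; 0 is a filler. *)
  exists (fun=> x), (fun=> 0); split=> //.
    by apply: monic_prod_roots => // -[|i] [|j].
  by move=> x'; rewrite p0 big_ord0.
have [pE qE ly yz] := H.
have [m2 s2] := pm k.+2.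
have [/= T] := @poly_pinfty_gt_lc _ (p k.+2) (eq_ind_r (fun v => 0 < v) ltr01 (monicP m2)).
rewrite (monicP m2) => hT; pose M := Num.max T (y k + 1).
(* The grid l, y_0, ..., y_k, M on which p_(k+2) alternates; M exceeds y_k and lies where the monic
   p_(k+2) is at least 1. *)
pose e j := if j is j'.+1 then if (j' <= k)%N then y j' else M else l.
have py i : (i <= k)%N -> (p k.+1).[y i] = 0.
  by move=> ik; rewrite pE (bigD1 (Ordinal (ik : (i < k.+1)%N))) //= subrr mul0r.
have es j : (j <= k.+2)%N -> 0 < (-1) ^+ (k.+2 - j) * (p k.+2).[e j].
  case: j => [|j] jk /=; first exact: pl.
  have [jk'|kj] := leqP j k.
    rewrite prec py // mulr0 sub0r subSS subSn // exprS mulN1r mulrNN mulrCA.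
    by rewrite mulr_gt0 // (interlacing_sign_qy H).
  have -> : j = k.+1 by apply/eqP; rewrite eqn_leq kj -ltnS jk.
  by rewrite subnn mul1r (lt_le_trans ltr01) // hT // le_max lexx.
have ei i : (i < k.+2)%N -> e i < e i.+1.
  case: i => [|i] ik; first exact: ly.
  rewrite /e (_ : (i <= k)%N) //; case: ifP => [ik'|/negbT].
    by have /andP[] := yz _ ik'; exact: lt_trans.
  move=> ki; have -> : i = k by lia.
  by rewrite lt_max ltrDl ltr01 orbT.
have /choice[w hw] : forall i, exists x, (i < k.+2)%N ->
    e i < x < e i.+1 /\ (p k.+2).[x] = 0.
  move=> i; have [ik|] := ltnP i k.+2; last by exists 0.
  have [|x xi px] := @poly_ivt_signs (p k.+2) _ _ _ _ (ei _ ik) _ (es _ (ltnW ik)) (es _ ik).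
    by rewrite -(subnSK ik) addSn addnn /= odd_double.
  by exists x.
exists w, y.
have wy i : (i < k.+1)%N -> w i < y i < w i.+1.
  move=> ik; have [/andP[_ h1] _] := hw _ (leqW ik).
  have [/andP[h2 _] _] := hw i.+1 ik; move: h1 h2; rewrite /= -ltnS ik => -> ->.
  by [].
have wi i : (i < k.+1)%N -> w i < w i.+1 by move=> /wy /andP[]; exact: lt_trans.
split=> //.
- apply: monic_prod_roots => // [i j ij jk|i ik]; last by have [] := hw _ ik.
  exact: (step_lt wi).
- by have [/andP[] ] := hw 0 isT.
Qed.

(** Writing s_i = xs_(K i), the map K is strictly increasing from {1, ..., m} to itself, hence the
    identity: K i >= i by upward induction and K i <= i by downward induction. *)
Lemma ordered_zeros_unique (f : R -> R) m (xs s : nat -> R) :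
  ordered_zeros f m xs ->
  (forall i, (1 <= i <= m)%N -> f (s i) = 0) ->
  (forall i, (1 <= i < m)%N -> s i < s i.+1) ->
  forall i, (1 <= i <= m)%N -> s i = xs i.
Proof.
move=> [xinc xz] s0 sinc.
have /choice[K hK] : forall i, exists k, (1 <= i <= m)%N -> (1 <= k <= m)%N /\ s i = xs k.
  move=> i; have [im|] := boolP (1 <= i <= m)%N; last by exists 0.
  by have /xz[k hk e] := s0 _ im; exists k.
have xle i j : (1 <= i)%N -> (i <= j)%N -> (j <= m)%N -> xs i <= xs j.
  by move=> i1; rewrite leq_eqVlt => /predU1P[->//|ij] jm; apply/ltW/xinc.
have Ki i : (1 <= i < m)%N -> (K i < K i.+1)%N.
  move=> im; have [h1 e1] : _ /\ _ := hK i ltac:(lia).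
  have [h2 e2] : _ /\ _ := hK i.+1 ltac:(lia).
  rewrite ltnNge; apply/negP => le; have := sinc _ im.
  by rewrite e1 e2 ltNge xle //; lia.
have Kge i : (1 <= i <= m)%N -> (i <= K i)%N.
  elim: i => // -[|i] IH im; first by have [/andP[]] := hK 1%N im.
  by have := Ki i.+1 ltac:(lia); have := IH ltac:(lia); lia.
have Kle d : (d < m)%N -> (K (m - d) <= m - d)%N.
  elim: d => [|d IH] dm.
    by have [] := hK (m - 0)%N ltac:(lia); lia.
  have := Ki (m - d.+1)%N ltac:(lia).
  by rewrite subnSK ?(ltnW dm) //; have := IH ltac:(lia); lia.
move=> i im; have [h ->] := hK _ im; congr xs.
by have := Kge _ im; have := Kle (m - i)%N ltac:(lia); rewrite subKn; lia.
Qed.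

End InterlacingZeros.

(** * Signs and zeros of the Meixner polynomials for b in (-2,-1) *)

Section MeixnerZeros.
Context {R : realType}.
Implicit Types (u b x : R) (n k : nat).

Lemma mpol_interlacing u b k : u < 0 -> 0 < b -> exists y z,
  interlacing_zeros (mpol u k.+1 b) (mpol u k b) 0 k y z.
Proof.
move=> u0 b0.
apply: (three_term_interlacing (p := fun k => mpol u k b)
  (A := fun n x => x + u * (b + n.+1%:R) - n.+1%:R * (1 - u))
  (B := fun n => n.+1%:R * (1 - u) * (- u * (b + n%:R)))) => {k}.
- by move=> k; exact: mpol_monic_size.
- by move=> k x; rewrite mpol_rec; ring.
- move=> k; rewrite !mulr_gt0 ?ltr0Sn ?oppr_gt0 //; first by lra.
  by apply: ltr_wpDr => //; exact: ler0n.
- move=> k; rewrite mpol_at0 mulrA -exprMn mulr_gt0 ?poch_gt0 //.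
  by rewrite exprn_gt0 // mulN1r oppr_gt0.
Qed.

(** Only the first factor, b + 1, is negative. *)
Lemma poch_b1_lt0 b n : -2 < b -> b < -1 -> poch (b + 1) n.+1 < 0.
Proof. by move=> b2 b1; rewrite pochSl nmulr_rlt0 ?poch_gt0 //; lra. Qed.

Lemma sign_expr_lt0 (v : R) n : v < 0 -> 0 < (-1) ^+ n * v ^+ n.
Proof. by move=> v0; rewrite -exprMn exprn_gt0 // mulN1r oppr_gt0. Qed.

Lemma mpol_sign0 u b n : u < 0 -> -2 < b -> b < -1 ->
  0 < (-1) ^+ n.+2 * (mpol u n.+2 b).[0].
Proof.
move=> u0 b2 b1; rewrite mpol_at0 mulrA mulr_gt0 ?sign_expr_lt0 // pochSl.
by rewrite nmulr_rgt0 ?poch_b1_lt0 //; lra.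
Qed.

Lemma natrDub_gt0 u b n : u < 0 -> b < -1 -> 0 < n%:R + u * b.
Proof.
move=> u0 b1; have n0 := ler0n R n; have : 0 < u * b by rewrite nmulr_rgt0 //; lra.
lra.
Qed.

Lemma mpol_sign1 u b n : u < 0 -> -2 < b -> b < -1 ->
  0 < (-1) ^+ n.+2 * (mpol u n.+2 b).[1].
Proof.
move=> u0 b2 b1; rewrite mpol_at1.
have -> : (-1) ^+ n.+2 * (u ^+ n.+1 * poch (b + 1) n.+1 * (n.+2%:R + u * b)) =
  ((-1) ^+ n.+1 * u ^+ n.+1) * - poch (b + 1) n.+1 * (n.+2%:R + u * b).
  by rewrite (exprS _ n.+1); ring.
by rewrite mulr_gt0 ?natrDub_gt0 // mulr_gt0 ?sign_expr_lt0 ?oppr_gt0 ?poch_b1_lt0.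
Qed.

Lemma mpol_sign_Nb1 u b n : u < 0 -> -2 < b -> b < -1 ->
  (u - 1) * b < n.+2%:R ->
  0 < (-1) ^+ n.+3 * (mpol u n.+2 b).[- b - 1].
Proof.
move=> u0 b2 b1 nb; rewrite mpol_at_Nb1.
have -> : (-1) ^+ n.+3 * (poch (b + 1) n.+1 * (u - 1) ^+ n.+1 * ((u - 1) * b - n.+2%:R)) =
  ((-1) ^+ n.+1 * (u - 1) ^+ n.+1) * - poch (b + 1) n.+1 * (n.+2%:R - (u - 1) * b).
  by rewrite (exprS _ n.+2) (exprS _ n.+1); ring.
by rewrite mulr_gt0 ?subr_gt0 // mulr_gt0 ?oppr_gt0 ?poch_b1_lt0 // sign_expr_lt0 //; lra.
Qed.

(** The recurrence removes the top term of [mpol_shift2]. For u < 0 and b < -1 the remaining factor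
    is positive by [natrDub_gt0], so the sign is inherited from the lower polynomial. *)
Lemma mpol_at_shifted_root1 u b k x : (mpol u k.+1 (b + 2)).[x] = 0 ->
  (mpol u k.+2 b).[x + 2] =
  k.+1%:R * (1 - u) * (k.+2%:R + u * b) * (mpol u k (b + 2)).[x].
Proof.
by move=> h; rewrite mpol_shift2 addrK mpol_rec h -!natr1; ring.
Qed.

Lemma mpol_at_shifted_root0 u b k x : (mpol u k (b + 2)).[x] = 0 ->
  (mpol u k.+2 b).[x + 2] = (x + k.+3%:R + u * b) * (mpol u k.+1 (b + 2)).[x].
Proof.
by move=> h; rewrite mpol_shift2 addrK mpol_rec h -!natr1; ring.
Qed.

Lemma mpol_at_root u b k x : (mpol u k.+2 b).[x] = 0 ->
  k.+1%:R * (1 - u) * (x * (x - 1)) * (mpol u k (b + 2)).[x - 2] =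
  - u * (b + k.+1%:R) * (x + k.+1%:R + u * b) * (mpol u k.+1 b).[x].
Proof. by move=> h; rewrite mpol_contiguous h mulr0 add0r. Qed.

(** Besides the zeros of M_(k+3), this records the signs of M_(k+2) there: equal at the first two
    zeros, alternating from the third on. *)
Lemma mpol_zeros u b k : u < 0 -> -2 < b -> b < -1 ->
  (u - 1) * b < k.+3%:R -> exists s : nat -> R,
  [/\ forall i, (1 <= i <= k.+3)%N -> (mpol u k.+3 b).[s i] = 0,
      0 < s 1%N < - b - 1,
      - b - 1 < s 2%N < 1 &
      2 < s 3%N /\
      [/\ forall i, (3 <= i < k.+3)%N -> s i < s i.+1,
       forall i, (1 <= i <= 2)%N -> 0 < (-1) ^+ k.+2 * (mpol u k.+2 b).[s i] &
       forall i, (3 <= i <= k.+3)%N ->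
         0 < (-1) ^+ (k.+3 - i) * (mpol u k.+2 b).[s i]]].
Proof.
move=> u0 b2 b1 hk.
have b20 : 0 < b + 2 by lra.
(* With n = k + 3, the points y_i + 2 and z_i + 2 are the zeros of r_(n-1) and r_(n-2). *)
have [y [z H]] := mpol_interlacing u (b + 2) k.+1 u0 b20.
have [pE qE y0 yz] := H.
have s0 := mpol_sign0 u b k.+1 u0 b2 b1; have s1 := mpol_sign1 u b k.+1 u0 b2 b1.
have sa := mpol_sign_Nb1 u b k.+1 u0 b2 b1 hk.
have a0 : 0 < - b - 1 by lra.
have a1 : - b - 1 < 1 by lra.
have odda : odd (k.+3 + k.+4) by rewrite addnS addnn /= odd_double.
have [t1 t1i t10] := poly_ivt_signs a0 odda s0 sa.
rewrite addnC in odda.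
have [t2 t2i t20] := poly_ivt_signs a1 odda sa s1.
have zpos i : (i < k.+1)%N -> 0 < z i.
  move=> ik; have [+ _] := interlacing_lt H (ltnSn i) ik.
  apply: lt_trans; case: i ik => // i ik; apply: lt_trans y0 _.
  by have [h1 h2] := interlacing_lt H (ltn0Sn i) (ltnW ik); exact: lt_trans h1 h2.
have qz i : (i < k.+1)%N -> (mpol u k.+1 (b + 2)).[z i] = 0.
  by move=> ik; rewrite qE (bigD1 (Ordinal ik)) //= subrr mul0r.
have py i : (i <= k.+1)%N -> (mpol u k.+2 (b + 2)).[y i] = 0.
  by move=> ik; rewrite pE (bigD1 (Ordinal (ik : (i < k.+2)%N))) //= subrr mul0r.
(* M_n changes sign from z_i + 2 to y_(i+1) + 2, which yields n - 2 zeros beyond 2. *)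
have /choice[w hw] : forall i, exists x, (i < k.+1)%N ->
    z i + 2 < x < y i.+1 + 2 /\ (mpol u k.+3 b).[x] = 0.
  move=> i; have [ik|] := ltnP i k.+1; last by exists 0.
  have zy : z i + 2 < y i.+1 + 2 by rewrite ltrD2r; case/andP: (yz _ ik).
  have sz : 0 < (-1) ^+ (k.+1 - i) * (mpol u k.+3 b).[z i + 2].
    rewrite mpol_at_shifted_root0 ?qz // mulrCA mulr_gt0 //.
      by rewrite -addrA addr_gt0 ?zpos ?natrDub_gt0.
    exact: interlacing_sign_pz H _ ik.
  have sy : 0 < (-1) ^+ (k.+1 - i.+1) * (mpol u k.+3 b).[y i.+1 + 2].
    rewrite mpol_at_shifted_root1 ?py // mulrCA mulr_gt0 //.
      by rewrite !mulr_gt0 ?natrDub_gt0 ?ltr0Sn //; lra.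
    exact: interlacing_sign_qy H _ ik.
  have [|x xi px] := poly_ivt_signs zy _ sz sy; last by exists x.
  by rewrite -(subnSK ik) addSn addnn /= odd_double.
have w2 i : (i < k.+1)%N -> 2 < w i.
  by move=> ik; have [/andP[+ _] _] := hw _ ik; have := zpos _ ik; lra.
pose s i := match i with 0 => 0 | 1 => t1 | 2 => t2 | j.+3 => w j end.
have sroot i : (1 <= i <= k.+3)%N -> (mpol u k.+3 b).[s i] = 0.
  by case: i => [|[|[|i]]] //= ik; have [] := hw _ ik.
(* The factor of M_(n-1) in the contiguous relation; goals are multiplied by it below to bring in
   r_(n-2). *)
have coefp x : 0 < x -> 0 < - u * (b + k.+2%:R) * (x + k.+2%:R + u * b).
  move=> x0; have k0 := ler0n R k; have ub := natrDub_gt0 u b k.+2 u0 b1.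
  apply: mulr_gt0; last by rewrite -addrA addr_gt0.
  by rewrite mulr_gt0 ?oppr_gt0 // -!natr1; lra.
have scoef : 0 < k.+2%:R * (1 - u) by rewrite mulr_gt0 ?ltr0Sn //; lra.
exists s; split=> //; split; first exact: w2.
split.
- case=> [|[|[|i]]] //= ik; rewrite !ltnS in ik.
  have [/andP[_ h1] _] := hw _ (leqW ik : (i < k.+1)%N).
  have [/andP[h2 _] _] := hw i.+1 ik.
  have [h3 _] := interlacing_lt H (ltnSn i.+1) ik; lra.
- move=> i i12.
  have ik : (1 <= i <= k.+3)%N by case: i i12 => [|[|[|]]].
  have e := mpol_at_root u b k.+1 (s i) (sroot i ik).
  (* Here x(x - 1) < 0 and x - 2 lies below every z_j, so the sign (-1)^(k+1) of r_(n-2) is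
     flipped. *)
  have [s0' s1'] : 0 < s i /\ s i < 1.
    have /andP[? ?] := t1i; have /andP[? ?] := t2i.
    by case: i i12 {ik e} => [|[|[|i]]] //= _; lra.
  have h : 0 < (-1) ^+ (k.+1 - 0) * (mpol u k.+1 (b + 2)).[s i - 2].
    apply: (interlacing_sign_q H) => // j /andP[_ jk].
    by have := zpos _ jk; lra.
  rewrite -(pmulr_rgt0 _ (coefp _ s0')) mulrCA -e {e}.
  move: h scoef; rewrite subn0 (exprS _ k.+1).
  move: (mpol _ _ _).[_] (_ * (1 - u)) ((-1) ^+ k.+1) => r C e h C0.
  have -> : -1 * e * (C * (s i * (s i - 1)) * r) = C * (s i * (1 - s i)) * (e * r).
    by ring.
  by rewrite mulr_gt0 // mulr_gt0 // mulr_gt0 // subr_gt0.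
- case=> [|[|[|i]]] //= ik.
  have [/andP[h1 h2] e0] := hw _ (ik : (i < k.+1)%N).
  have wi := w2 _ (ik : (i < k.+1)%N).
  have e := mpol_at_root u b k.+1 _ e0.
  have w0 : 0 < w i by lra.
  rewrite -(pmulr_rgt0 _ (coefp _ w0)) mulrCA -e mulrCA mulr_gt0 //.
    by rewrite !mulr_gt0 //; lra.
  (* The zeros z_0, ..., z_i are exactly those below w_i - 2, hence the index i + 1. *)
  rewrite !subSS -(subSS i k); apply: (interlacing_sign_q H) => // j.
    rewrite ltnS leq_eqVlt => /predU1P[->|ji]; first by lra.
    have [_ ] := interlacing_lt H ji (ltnW ik).
    by have /andP[+ _] := yz _ ik; lra.
  rewrite leq_eqVlt => /andP[/predU1P[<-|ij] jk].
    by have /andP[+ _] := yz _ jk; lra.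
  have [? ?] := interlacing_lt H ij (ltnW jk).
  by have /andP[+ _] := yz _ jk; lra.
Qed.

End MeixnerZeros.

(** * Interlacing of the zeros of consecutive Meixner polynomials *)

Theorem theorem4p6 (R : realType) (beta c : R) (n : nat)
  (hbeta : -2 < beta < -1) (hc : 0 < c < 1) (hn : (3 <= n)%N)
  (hnb : n%:R - 1 > beta / (c - 1))
  (hnocommon : forall x : R,
      ~ (meixner n beta c x = 0 /\ meixner n.-1 beta c x = 0))
  (xn xn1 : nat -> R)
  (hxn : ordered_zeros (meixner n beta c) n xn)
  (hxn1 : ordered_zeros (meixner n.-1 beta c) n.-1 xn1) :
  (0 < xn 1%N /\ xn 1%N < xn1 1%N /\ xn1 1%N < - beta - 1 /\
   - beta - 1 < xn1 2%N /\ xn1 2%N < xn 2%N /\ xn 2%N < - beta /\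
   - beta < xn 3%N) /\
  (forall k : nat, (3 <= k <= n.-1)%N ->
     xn k < xn1 k /\ xn1 k < xn k.+1).
Proof.
have /andP[b2 b1] := hbeta; have /andP[c0 c1] := hc.
have c10 : c - 1 < 0 by rewrite subr_lt0.
have cN0 : c != 0 by rewrite gt_eqF.
have cN1 : c != 1 by rewrite lt_eqF.
have bN i : beta + i%:R != 0.
  case: i => [|[|i]]; try by rewrite lt_eqF //=; lra.
  by rewrite gt_eqF // -2!natr1; have := ler0n R i; lra.
set u := c / (c - 1).
have u0 : u < 0 by rewrite pmulr_rlt0 // invr_lt0.
have mE m x : meixner m beta c x = (mpol u m beta).[x] by exact: meixnerE.
have ub : (u - 1) * beta = beta / (c - 1).
  by rewrite /u; field; rewrite lt_eqF.
case: n hn hnb hnocommon hxn hxn1 => [|[|[|k]]] //= _ hnb _ hxn hxn1.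
(* The bound on n - 1 fixes the sign at -b - 1 in both degrees n - 1 = k + 2 and n = k + 3. *)
have hk2 : (u - 1) * beta < k.+2%:R by rewrite ub; move: hnb; rewrite -(natr1 k.+2) addrK.
have hk3 : (u - 1) * beta < k.+3%:R by rewrite -natr1; lra.
have [s [sroot s1 s2 [s3 [sinc sg12 sg3]]]] := mpol_zeros u beta k u0 b2 b1 hk3.
have /andP[s1l s1u] := s1; have /andP[s2l s2u] := s2.
have sx : forall i, (1 <= i <= k.+3)%N -> s i = xn i.
  apply: (ordered_zeros_unique hxn) => [i ik|]; first by rewrite mE sroot.
  by case=> [|[|[|i]]] // ik; [lra|lra|exact: sinc].
(* At -b - 1 the sign of M_(n-1) is opposite to its common sign at s_1 and s_2, so one zero lies on
   each side of -b - 1. *)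
have sa := mpol_sign_Nb1 u beta k u0 b2 b1 hk2.
have odda : odd (k.+2 + k.+3) by rewrite addnS addnn /= odd_double.
have [t1 t1i t10] := poly_ivt_signs s1u odda (sg12 1%N isT) sa.
rewrite addnC in odda.
have [t2 t2i t20] := poly_ivt_signs s2l odda sa (sg12 2%N isT).
(* The alternation from s_3 on supplies the other n - 3 zeros. *)
have /choice[t ht] : forall i, exists x, (3 <= i < k.+3)%N ->
    s i < x < s i.+1 /\ (mpol u k.+2 beta).[x] = 0.
  move=> i; have [ik|] := boolP (3 <= i < k.+3)%N; last by exists 0.
  have /andP[i3 ik'] := ik.
  have [|||x xi px] := poly_ivt_signs (sinc _ ik) _ (sg3 i _) (sg3 i.+1 _).
  - by rewrite -(subnSK ik') addSn addnn /= odd_double.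
  - by rewrite i3 ltnW.
  - by rewrite ltnW.
  - by exists x.
pose w i := match i with 0 => 0 | 1 => t1 | 2 => t2 | _ => t i end.
have /andP[t1l t1u] := t1i; have /andP[t2l t2u] := t2i.
have wx : forall i, (1 <= i <= k.+2)%N -> w i = xn1 i.
  apply: (ordered_zeros_unique hxn1) => [i ik|].
    by rewrite mE; case: i ik => [|[|[|i]]] //= ik; have [] := ht i.+3 ik.
  case=> [|[|[|i]]] //= ik; first by lra.
    by have [/andP[+ _] _] := ht 3%N ik; lra.
  have [/andP[_ h1] _] := ht i.+3 (ltnW ik).
  have [/andP[h2 _] _] := ht i.+4 ik.
  exact: lt_trans h1 h2.
(* The place of -b follows from s_2 < 1 < -b < 2 < s_3. *)
rewrite -!sx // -!wx //=; split; first by do !split=> //; lra.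
move=> [|[|[|i]]] // ik.
have [/andP[h1 h2] _] := ht i.+3 ik.
by rewrite -wx // -!sx //; case/andP: ik => _ ik; exact: ltnW.
Qed.
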